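(* Let $f:M\to M$ be a continuous map on a compact, finite-dimensional manifold $M$, let $\mu$ be an $f$-invariant Borel probability measure, and let $\Phi=\{\phi_n\}_{n\ge 1}$ be a subadditive potential on $M$. If the growth rates of $\Phi$ satisfy $$\Phi^*(x):=\lim_{n\to\infty}\frac1n\phi_n(x)<0\quad\text{for }\mu\text{-a.e. }x\in M,$$ then there exists $\epsilon>0$ such that $\widetilde\Phi^*(x)<0$ for each point $x\in\mathcal S_\epsilon(\mu)$.
   Context: $\mathcal M$ denotes the set of all Borel probability measures on $M$ with the weak$^*$ topology, and $\mathrm{dist}^*$ is a fixed metric on $\mathcal M$ inducing this topology. For $\mu\in\mathcal M$ and $\epsilon>0$, $\mathcal N_\epsilon(\mu)$ is the $\epsilon$-neighborhood of $\mu$ in the metric $\mathrm{dist}^*$. For $x\in M$, the empirical measures are $\delta_{x,n}=\frac1n\sum_{j=0}^{n-1}\delta_{f^j(x)}$, where $\delta_y$ is the Dirac measure at $y$. $\mathcal V_f(x)$ is the set of all weak$^*$ limits of convergent subsequences of $(\delta_{x,n})_{n\ge1}$. The strong basin of $\epsilon$-attraction of $\mu$ is $\mathcal S_\epsilon(\mu)=\{x\in M:\mathcal V_f(x)\subset\mathcal N_\epsilon(\mu)\}$. A subadditive potential on $M$ is a sequence $\Phi=\{\phi_n\}_{n\ge1}$ of continuous real functions on $M$ with $\phi_{n+m}(x)\le\phi_n(x)+\phi_m(f^n x)$ for all $x\in M$ and $n,m\in\mathbb N$ (positive integers). By Kingman's subadditive ergodic theorem the limit $\Phi^*(x)$ exists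 (possibly $-\infty$) for $\mu$-a.e. $x$, for every $f$-invariant probability $\mu$. The largest growth rate at any $x\in M$ is $\widetilde\Phi^*(x):=\limsup_{n\to\infty}\frac1n\phi_n(x)$. *)

(* Defs.v *)
From HB Require Import structures.
From mathcomp Require Import all_boot all_order all_algebra.
From mathcomp Require Import all_classical all_reals all_analysis.

Set Implicit Arguments.
Unset Strict Implicit.
Unset Printing Implicit Defensive.

Import Order.TTheory GRing.Theory Num.Theory.
Import numFieldNormedType.Exports.

Local Open Scope classical_set_scope.
Local Open Scope ring_scope.

Definition euclidean_at (R : realType) (d : nat) (M : topologicalType)
    (x : M) : Prop :=
  exists (U : set M) (V : set 'rV[R]_d) (h : M -> 'rV[R]_d) (g : 'rV[R]_d -> M),
    [/\ open U, U x & open V] /\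
    [/\ set_fun U V h, set_fun V U g,
        {in U, cancel h g} & {in V, cancel g h}] /\
    {within U, continuous h} /\ {within V, continuous g}.

(* A topological manifold without boundary, of dimension [d]. *)
Record is_manifold (R : realType) (d : nat) (M : topologicalType) : Prop := {
  manifold_hausdorff : hausdorff_space M ;
  manifold_second_countable : @second_countable M ;
  manifold_locally_euclidean : forall x : M, euclidean_at R d x }.

Notation borel M := (g_sigma_algebraType (@open M)).

Notation borel_probability M R := (probability (borel M) R).

(* [initial_topology] along a map into a product of copies of [R] indexed by
   C(M): the coarsest topology making every [nu |-> \int[nu]_x phi x]
   continuous. *)
Definition integrals (M : ptopologicalType) (R : realType)
    (nu : borel_probability M R) : prod_topology (fun _ : continuousType M R => R) :=
  fun phi => \int[nu]_x phi x.

Definition weak_star (M : ptopologicalType) (R : realType) : topologicalType :=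
  initial_topology (@integrals M R).

Definition metric_nbhd (M : ptopologicalType) (R : realType)
    (dist : borel_probability M R -> borel_probability M R -> R)
    (mu : borel_probability M R) (e : R) : set (borel_probability M R) :=
  [set nu | dist mu nu < e].

(* A [probability] is a set function on all subsets, so two different ones may
   agree on every Borel set, that is, represent the same Borel measure. Hence
   points are separated up to agreement on Borel sets and not up to [=], which
   no metric inducing the weak-star topology could satisfy when M has a
   non-Borel subset.
   By [wsm_nbhs], [dist] does not depend on the choice of representatives. *)
Record weak_star_metric (M : ptopologicalType) (R : realType)
    (dist : borel_probability M R -> borel_probability M R -> R) : Prop := {
  wsm_refl : forall mu, dist mu mu = 0 ;
  wsm_eq : forall mu nu, dist mu nu = 0 ->
    forall A : set (borel M), measurable A -> mu A = nu A ;
  wsm_sym : forall mu nu, dist mu nu = dist nu mu ;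
  wsm_triangle : forall mu nu rho, dist mu rho <= dist mu nu + dist nu rho ;
  wsm_nbhs : forall mu : weak_star M R,
    nbhs mu = filter_from [set e : R | 0 < e] (metric_nbhd dist mu) }.

Section empirical_measure.
Variables (R : realType) (M : ptopologicalType) (f : M -> M) (x : M) (n : nat).
Local Open Scope ereal_scope.

(* Index shift: [empirical n] averages over the [n + 1] points
   x, f x, ..., f^n x, i.e. it is the usual delta_{x,n+1}. *)
Definition empirical : set (borel M) -> \bar R :=
  mscale (n.+1%:R^-1)%:nng%R
    (msum (fun j : nat => dirac (iter j f x : borel M)) n.+1).

HB.instance Definition _ := Measure.on empirical.

Let empirical_setT : empirical setT = 1.
Proof.
rewrite /empirical /mscale /= /msum.
rewrite (eq_bigr (fun=> 1)) => [|j _]; last by rewrite /= diracT.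
by rewrite sumEFin -EFinM sumr_const card_ord mulVf// pnatr_eq0.
Qed.

HB.instance Definition _ :=
  Measure_isProbability.Build _ _ _ empirical empirical_setT.

End empirical_measure.

Definition empirical_limits (R : realType) (M : ptopologicalType)
    (f : M -> M) (x : M) : set (weak_star M R) :=
  [set nu | exists2 k : nat -> nat, increasing_seq k &
    (fun i => (empirical R f x (k i) : borel_probability M R) : weak_star M R)
      @ \oo --> nu].

Definition strong_basin (R : realType) (M : ptopologicalType)
    (dist : borel_probability M R -> borel_probability M R -> R)
    (f : M -> M) (mu : borel_probability M R) (e : R) : set M :=
  [set x | @empirical_limits R M f x `<=` metric_nbhd dist mu e].

Definition invariant_measure (R : realType) (M : ptopologicalType)
    (f : M -> M) (mu : borel_probability M R) : Prop :=
  forall A : set (borel M), measurable A -> mu (f @^-1` A) = mu A.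

(* [Phi n] is only constrained for [0 < n]; [Phi 0] is a dummy. *)
Record subadditive_potential (R : realType) (M : topologicalType)
    (f : M -> M) (Phi : nat -> M -> R) : Prop := {
  subadditive_continuous : forall n, (0 < n)%N -> continuous (Phi n) ;
  subadditive_le : forall n m x, (0 < n)%N -> (0 < m)%N ->
    Phi (n + m)%N x <= Phi n x + Phi m (iter n f x) }.

(* Extended-real valued, since growth rates may be [-oo]. *)
Definition mean_growth (R : realType) (M : Type) (Phi : nat -> M -> R) (x : M) :
    nat -> \bar R :=
  fun n => (n%:R^-1 * Phi n x)%:E.

Definition growth_rate (R : realType) (M : Type) (Phi : nat -> M -> R) (x : M) :
    \bar R :=
  limn (mean_growth Phi x).

Definition largest_growth_rate (R : realType) (M : Type) (Phi : nat -> M -> R)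
    (x : M) : \bar R :=
  limn_esup (mean_growth Phi x).

(* Main.v *)
(* By Fatou's lemma, some N has negative mu-integral of Phi N; this remains true
   with a uniform margin on a weak-star neighbourhood of mu. Subadditivity
   bounds N * Phi n by the Birkhoff sum of Phi N up to a constant, so it
   suffices that the averages of Phi N along the orbit of x be eventually
   negative and bounded away from 0: otherwise, by sequential compactness of the
   space of probability measures, some limit of the empirical measures would
   lie outside the neighbourhood.

   Sequential compactness is obtained without Riesz representation. A countable
   basis B_i codes the points of M by binary sequences, closure B_i and the
   complement of B_i being the two pieces at level i. Along a subsequence the
   masses of all finite codes converge; subdividing [0, 1[ according to the
   limit masses gives a map from [0, 1[ to codes, hence to M, and the image of
   Lebesgue measure under it is the limit measure. *)
Require Import Defs.
From HB Require Import structures.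
From mathcomp Require Import all_boot all_order all_algebra.
From mathcomp Require Import all_classical all_reals all_analysis.
From mathcomp Require Import measurable_realfun lra.
Import Order.TTheory GRing.Theory Num.Theory.
Import numFieldNormedType.Exports.
Local Open Scope classical_set_scope.
Local Open Scope ring_scope.

Set Implicit Arguments.
Unset Strict Implicit.
Unset Printing Implicit Defensive.

(** * Binary codes of the points of a compact space *)

Lemma compact_nested_nonempty (T : topologicalType) (F : nat -> set T) :
  compact [set: T] -> (forall n, closed (F n)) ->
  (forall n, F n.+1 `<=` F n) -> (forall n, F n !=set0) ->
  \bigcap_n F n !=set0.
Proof.
move=> cT cF dF F0.
have sF m n : (m <= n)%N -> F n `<=` F m.
  move=> /subnK <-; elim: (n - m)%N => [//|k IH]; rewrite addSn.
  exact: subset_trans (dF _) IH.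
have pF : ProperFilter (filter_from [set: nat] F).
  apply: filter_from_proper => //; apply: filter_from_filter; first by exists 0%N.
  move=> i j _ _; exists (maxn i j) => // x Fx.
  by split; apply: sF Fx; rewrite ?leq_maxl ?leq_maxr.
have [|p [_ clp]] := cT (filter_from [set: nat] F) pF; first by exists 0%N.
exists p => n _; apply: (cF n) => U Up.
by apply: clp => //; exists n.
Qed.

Section coding.
Variables (M : topologicalType) (B : nat -> set M).
Hypothesis cM : compact [set: M].
Hypothesis oB : forall i, open (B i).
Hypothesis sepB : forall x y, x <> y -> exists2 i, B i x & ~ closure (B i) y.

(* The boundary of [B i] lies in both pieces, so a point may have several
   codes, but a code determines its point. *)
Definition piece (i : nat) (b : bool) : set M :=
  if b then closure (B i) else ~` B i.

(** Membership is tested in [B i] and not in its closure, so the sets of points sharing a code word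
    are Borel and disjoint for distinct words of one length; cylinders are closed and may
    overlap. *)
Definition code (y : M) (i : nat) : bool := `[< B i y >].

Definition cylinder (w : seq bool) : set M :=
  [set y | forall i, (i < size w)%N -> piece i (nth false w i) y].

Lemma closed_piece i b : closed (piece i b).
Proof.
by case: b => /=; [exact: closed_closure|exact: open_closedC].
Qed.
Arguments closed_piece : clear implicits.

Lemma closed_cylinder w : closed (cylinder w).
Proof.
rewrite (_ : cylinder w =
  \bigcap_(i in [set i | (i < size w)%N]) piece i (nth false w i)) //.
by apply: closed_bigI => i _; exact: closed_piece.
Qed.
Arguments closed_cylinder : clear implicits.

Lemma cylinder_rcons w b : cylinder (rcons w b) `<=` cylinder w.
Proof.
move=> y yw i iw; have := yw i; rewrite size_rcons nth_rcons iw; apply.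
exact: ltnW.
Qed.

Lemma cylinder_mkseqS (h : nat -> bool) n :
  cylinder (mkseq h n.+1) `<=` cylinder (mkseq h n).
Proof. by rewrite mkseqS; exact: cylinder_rcons. Qed.

Lemma cylinder_code y n : cylinder (mkseq (code y) n) y.
Proof.
move=> i; rewrite size_mkseq => ilt; rewrite nth_mkseq// /piece /code.
case: asboolP => // By; exact: subset_closure.
Qed.

Lemma same_piece_eq x y :
  (forall i, exists b, piece i b x /\ piece i b y) -> x = y.
Proof.
move=> h; apply: contrapT => /sepB[i Bix cBiy].
by have [[] [] /=] := h i.
Qed.

(** The closed set [C] serves two purposes: the complement of an open set when the decoding map is
    shown measurable, the whole space when that map is built. *)
Lemma decode (h : nat -> bool) (C : set M) : closed C ->
  (forall n, cylinder (mkseq h n) `&` C !=set0) ->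
  exists2 y, C y & forall n, cylinder (mkseq h n) y.
Proof.
move=> cC h0.
have [||y yh] :=
  @compact_nested_nonempty _ (fun n => cylinder (mkseq h n) `&` C) cM _ _ h0.
- by move=> n; exact: closedI (closed_cylinder _) cC.
- by move=> n; apply: setSI; exact: cylinder_mkseqS.
by exists y => [|n]; [have [] := yh 0%N I|have [] := yh n I].
Qed.

Lemma decode_uniq (h : nat -> bool) x y :
  (forall n, cylinder (mkseq h n) x) -> (forall n, cylinder (mkseq h n) y) ->
  x = y.
Proof.
move=> hx hy; apply: same_piece_eq => i; exists (h i).
have := (hx i.+1 i, hy i.+1 i).
by rewrite size_mkseq !nth_mkseq// => -[h1 h2]; split; [exact: h1|exact: h2].
Qed.

(** Compactness of the square: pairs that share a piece at each of the first [n] levels while [phi]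
    differs by at least [e] form decreasing closed sets [D n]. A common point of all of them would
    lie on the diagonal, where the difference is 0. *)
Lemma cylinder_oscillation (R : realType) (phi : M -> R) (e : R) :
  continuous phi -> 0 < e ->
  exists n, forall w x y, size w = n -> cylinder w x -> cylinder w y ->
    `|phi x - phi y| < e.
Proof.
move=> cphi e0.
pose D n : set (M * M) := [set z | e <= `|phi z.1 - phi z.2|] `&`
  [set z | forall i, (i < n)%N -> exists b, piece i b z.1 /\ piece i b z.2].
have [D0|] := pselect (forall n, D n !=set0); last first.
  move=> /existsNP[n Dn]; exists n => w x y sw wx wy.
  rewrite ltNge; apply/negP => exy; apply: Dn; exists (x, y); split => //= i ilt.
  by exists (nth false w i); split; [apply: wx|apply: wy]; rewrite sw.
have cMM : compact [set: M * M] by rewrite -setXTT; exact: compact_setX.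
have cproj1 i b : closed [set z : M * M | piece i b z.1].
  by apply: (@closed_comp _ _ fst); [move=> ? _; exact: cvg_fst|exact: closed_piece].
have cproj2 i b : closed [set z : M * M | piece i b z.2].
  by apply: (@closed_comp _ _ snd); [move=> ? _; exact: cvg_snd|exact: closed_piece].
have [||z zD] := compact_nested_nonempty cMM _ _ D0.
- move=> n; apply: closedI.
    apply: (@closed_comp _ _ (fun z : M * M => `|phi z.1 - phi z.2|)
      [set r | e <= r]); last exact: closed_ge.
    move=> z _; apply: cvg_norm; apply: cvgB.
      by apply: continuous_comp; [exact: cvg_fst|exact: cphi].
    by apply: continuous_comp; [exact: cvg_snd|exact: cphi].
  rewrite (_ : [set z | _] = \bigcap_(i in [set i | (i < n)%N])
    (([set z : M * M | piece i true z.1] `&` [set z | piece i true z.2]) `|`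
     ([set z | piece i false z.1] `&` [set z | piece i false z.2]))).
    apply: closed_bigI => i _; apply: closedU; exact: closedI.
  apply/seteqP; split => z /= h i /h; first by move=> [[] ?]; [left|right].
  by move=> [] ?; [exists true|exists false].
- by move=> n z [? h]; split => // i ilt; apply: h; exact: ltnW.
have z12 : z.1 = z.2.
  by apply: same_piece_eq => i; have [_] := zD i.+1 I; exact.
by have [] := zD 0%N I; rewrite /= z12 subrr normr0 leNgt e0.
Qed.

End coding.

(** By regularity, [x] has a neighbourhood whose closure misses [y]; a basis element around [x]
    inside it separates the two points. *)
Lemma second_countable_separating (M : topologicalType) :
  hausdorff_space M -> compact [set: M] -> @second_countable M ->
  exists2 B : nat -> set M, (forall i, open (B i)) &
    forall x y, x <> y -> exists2 i, B i x & ~ closure (B i) y.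
Proof.
move=> hM cM [B /countable_injP[k kI] [oB bB]].
(* The basis element with number [i], or the empty set if [i] numbers none. *)
exists (fun i => \bigcup_(U in [set U | B U /\ k U = i]) U).
  by move=> i; apply: bigcup_open => U [/oB].
move=> x y xy.
have [V Vx Vy] : exists2 V, nbhs x V & ~ closure V y.
  have nx : nbhs x (~` [set y]).
    apply: open_nbhs_nbhs; split; last exact: xy.
    by apply: closed_openC; apply: accessible_closed_set1; exact: hausdorff_accessible.
  have [V xV VC] := compact_regular hM cM filterT nx.
  by exists V => // /VC; exact.
have [U [BU Ux] UV] := bB _ _ Vx.
exists (k U); first by exists U.
rewrite (_ : \bigcup_(_ in _) _ = U); first by move=> /(closure_subset UV).
apply/seteqP; split => [z [W [BW kW] Wz]|z Uz]; last by exists U.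
by rewrite -(kI W U) ?inE.
Qed.

(** * Pointwise convergence and extraction of subsequences *)

Lemma cvg_prod_topologyP (I : Type) (Z : topologicalType) (F : set_system (I -> Z))
  (g : prod_topology (fun _ : I => Z)) : Filter F ->
  F --> g <-> forall i, v i @[v --> F] --> g i.
Proof.
move=> FF; rewrite cvg_sup; split => h i.
  apply: cvg_trans; first exact: cvg_app (h i).
  exact: (@initial_continuous _ _ (fun f : I -> Z => f i) g).
by move=> U [_ [[W oW <-]] /= Wg /filterS]; apply; apply: h; exact: open_nbhs_nbhs.
Qed.

Lemma nbhs_prod_topology (I : Type) (Z : topologicalType)
  (p : prod_topology (fun _ : I => Z)) (i : I) (W : set Z) :
  nbhs (p i) W -> nbhs p [set v : prod_topology (fun _ : I => Z) | W (v i)].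
Proof. by move=> pW; have /cvg_prod_topologyP := @cvg_id _ (nbhs p); apply. Qed.

(** Tychonoff gives a cluster point [p] in the product of unit intervals. The subsequence is then
    built by hand: its [n]-th term is within 1/(n+1) of [p] in the first [n] coordinates. *)
Lemma bounded_subsequence (R : realType) (u : nat -> nat -> R) :
  (forall n i, 0 <= u n i <= 1) ->
  exists2 k : nat -> nat, increasing_seq k &
    exists p : nat -> R, forall i, u (k n) i @[n --> \oo] --> p i.
Proof.
move=> u01.
pose A := [set v : prod_topology (fun _ : nat => R) | forall i, v i \in `[0, 1]%R].
have cA : compact A.
  have := @tychonoff nat (fun=> R) (fun=> [set` `[0, 1]%R]).
  by apply => i; exact: segment_compact.
pose F := (u n : prod_topology (fun _ : nat => R)) @[n --> \oo].
have [|p [_ clp]] := cA F _.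
  by exists 0%N => // n _ i; rewrite in_itv/= u01.
have step m n : exists2 k, (m <= k)%N &
    forall i : 'I_n, `|p i - u k i| < n.+1%:R^-1.
  have Fm : F (u @` [set k | (m <= k)%N]).
    by exists m => // k /= mk; exists k.
  have pn : nbhs p [set v : prod_topology (fun _ : nat => R) |
      forall i : 'I_n, `|p i - v i| < n.+1%:R^-1].
    apply: (@filter_forall _ 'I_n
      (fun i v => `|p i - v i| < n.+1%:R^-1) (nbhs p)) => i.
    apply: (@nbhs_prod_topology _ R p i [set r | `|p i - r| < n.+1%:R^-1]).
    by apply: (nbhsx_ballx (p i : R) n.+1%:R^-1); rewrite invr_gt0 ltr0n.
  by have [_ [[k mk <-] uk]] := clp _ _ Fm pn; exists k.
have [g gle gP] : exists2 g : nat -> nat -> nat, forall m n, (m <= g m n)%N &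
    forall m n (i : 'I_n), `|p i - u (g m n) i| < n.+1%:R^-1.
  have [g gP] := choice (fun mn : nat * nat =>
    let: ex_intro2 k a b := step mn.1 mn.2 in ex_intro (fun k => (mn.1 <= k)%N /\
     forall i : 'I_mn.2, `|p i - u k i| < mn.2.+1%:R^-1) k (conj a b)).
  by exists (fun m n => g (m, n)) => m n; [have [] := gP (m, n)|have [_] := gP (m, n)].
pose k := fix k n := if n is n'.+1 then g (k n').+1 n else g 0%N 0%N.
have kP n i : (i < n)%N -> `|p i - u (k n) i| < n.+1%:R^-1.
  by case: n => // n ilt; exact: (gP _ n.+1 (Ordinal ilt)).
exists k; first by apply/increasing_seqP => n; exact: gle.
exists p => i; apply/cvgrPdist_lt => e e0.
near=> n.
apply: (lt_trans (kP n i _)); first by near: n; exact: nbhs_infty_gt.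
near: n; exact: near_infty_natSinv_lt (PosNum e0).
Unshelve. all: by end_near. Qed.

(** * Random binary sequences with prescribed masses of words *)

Section unit_lebesgue.
Variable R : realType.

Definition unit_lebesgue : set (measurableTypeR R) -> \bar R :=
  mrestr (@lebesgue_measure R) (measurable_itv `[(0:R), 1[).

HB.instance Definition _ := Measure.on unit_lebesgue.

Let unit_lebesgue_setT : unit_lebesgue setT = 1%E.
Proof.
rewrite /unit_lebesgue /mrestr setTI lebesgue_measure_itv/= lte_fin ltr01.
by rewrite oppr0 adde0.
Qed.

HB.instance Definition _ :=
  Measure_isProbability.Build _ _ _ unit_lebesgue unit_lebesgue_setT.

End unit_lebesgue.

Section tree_measure.
Variables (R : realType) (p : seq bool -> R).
Hypothesis p_ge0 : forall w, 0 <= p w.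
Hypothesis p_nil : p [::] = 1.
Hypothesis p_rcons : forall w, p w = p (rcons w false) + p (rcons w true).

(* The intervals [left w, left w + p w[ with w of length n are consecutive in
   lexicographic order and subdivide [0, 1[. *)
Let left (w : seq bool) : R :=
  \sum_(i < size w | nth false w i) p (rcons (take i w) false).

Let left_rcons w b :
  left (rcons w b) = left w + (if b then p (rcons w false) else 0).
Proof.
rewrite /left size_rcons big_mkcond big_ord_recr/= nth_rcons ltnn eqxx.
rewrite -cats1 take_size_cat//; congr (_ + _).
rewrite [RHS]big_mkcond; apply: eq_bigr => i _ /=.
by rewrite nth_cat ltn_ord takel_cat// ltnW.
Qed.

(** Binary search: each digit tells whether [t] lies in the right-hand part of the current interval,
    so for [t] in [0, 1[ the result is the word of length [n] whose cell contains [t]. *)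
Let Fixpoint prefix (t : R) n : seq bool :=
  if n is n'.+1 then
    rcons (prefix t n') (left (prefix t n') + p (rcons (prefix t n') false) <= t)
  else [::].

Let digit (t : R) n := left (prefix t n) + p (rcons (prefix t n) false) <= t.

Let prefix_digit t n : prefix t n = mkseq (digit t) n.
Proof. by elim: n => //= n IH; rewrite mkseqS -IH. Qed.

Let cell (w : seq bool) : set R := `[left w, left w + p w[%classic.

Let cell_nil : cell [::] = `[0, 1[%classic.
Proof. by rewrite /cell p_nil /left big_ord0 add0r. Qed.

Let cell_rcons w b : cell (rcons w b) `<=` cell w.
Proof.
move=> t; rewrite /cell /= !in_itv/= left_rcons (p_rcons w).
by have := p_ge0 (rcons w true); have := p_ge0 (rcons w false); case: b; lra.
Qed.

Let cell_unit w : cell w `<=` `[0, 1[%classic.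
Proof.
rewrite -cell_nil; elim/last_ind: w => // w b; apply: subset_trans.
exact: cell_rcons.
Qed.

Let prefix_cell t n : t \in `[0, 1[ -> cell (prefix t n) t.
Proof.
move=> t01; elim: n => [|n]; first by rewrite cell_nil.
rewrite /= /cell /= !in_itv/= left_rcons => /andP[le lt].
case h : (left (prefix t n) + p (rcons (prefix t n) false) <= t).
  by rewrite h -addrA -p_rcons.
by rewrite addr0 le ltNge h.
Qed.

Let cell_prefix t w : cell w t -> prefix t (size w) = w.
Proof.
elim/last_ind: w => // w b IH wbt.
have wt := cell_rcons wbt; rewrite size_rcons /= IH//; congr rcons.
move: wbt; rewrite /cell /= in_itv/= left_rcons; case: b => /andP[le lt] //.
by apply/negbTE; rewrite -ltNge; move: lt; rewrite addr0.
Qed.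

(* Truncated to 0 outside [0, 1[, so that every point has a digit expansion. *)
Let trunc (t : R) := if t \in `[0, 1[ then t else 0.

Let trunc01 t : trunc t \in `[0, 1[.
Proof. by rewrite /trunc; case: ifP => // _; rewrite in_itv/= lexx ltr01. Qed.

(** The digits of a Lebesgue-random [t] spell [w] exactly on [cell w], of length [p w]. Cells are
    half-open, hence empty when [p w] is 0, so a word of mass 0 never occurs at all; this lets every
    [t] be decoded to a point. *)
Lemma tree_measure : exists (P : probability (measurableTypeR R) R)
  (h : measurableTypeR R -> nat -> bool),
  [/\ forall n w, measurable [set t | mkseq (h t) n = w],
      forall w, P [set t | mkseq (h t) (size w) = w] = (p w)%:E &
      forall t n, 0 < p (mkseq (h t) n)].
Proof.
have inE01 w : [set t | mkseq (digit (trunc t)) (size w) = w] `&` `[0, 1[%classic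
    = cell w.
  apply/seteqP; split => [t [/= <- t01]|t wt].
    by rewrite -prefix_digit /trunc t01; exact: prefix_cell.
  have t01 := cell_unit wt; split => //=.
  by rewrite -prefix_digit /trunc t01 cell_prefix.
exists (@unit_lebesgue R), (fun t => digit (trunc t)); split.
- move=> n w; have [<-{n}|nw] := eqVneq (size w) n; last first.
    rewrite [X in measurable X](_ : _ = set0)//; apply/seteqP; split => // t /= tw.
    by move: nw; rewrite -tw size_mkseq eqxx.
  (* All points outside [0, 1[ carry the digits of 0, so they belong to the set exactly when [w] is
     a prefix of those digits. *)
  have [w0|w0] := pselect (mkseq (digit 0) (size w) = w).
  + rewrite [X in measurable X](_ : _ = cell w `|` ~` `[0, 1[%classic).
      by apply: measurableU; [exact: measurable_itv|
        apply: measurableC; exact: measurable_itv].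
    rewrite -inE01; apply/seteqP; split => t /=.
      by move=> tw; have [t01|t01] := boolP (t \in `[0, 1[); [left|right => /negP; apply].
    by case=> [[]//|/negP/negbTE]; rewrite /trunc => ->.
  + rewrite [X in measurable X](_ : _ = cell w); first exact: measurable_itv.
    rewrite -inE01; apply/seteqP; split => t /= [] //.
    move=> tw; split => //; apply: contrapT => /negP/negbTE t01.
    by apply: w0; move: tw; rewrite /trunc t01.
- move=> w; rewrite [LHS](_ : _ = lebesgue_measure (cell w)); last first.
    by rewrite -inE01.
  rewrite lebesgue_measure_itv/= lte_fin ltrDl.
  case: ltP => [_|p0]; first by rewrite -EFinB addrAC subrr add0r.
  by rewrite (le_anti (introT andP (conj p0 (p_ge0 w)))).
- move=> t n; have := prefix_cell n (trunc01 t); rewrite -prefix_digit.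
  by rewrite /cell /= in_itv/=; lra.
Qed.

End tree_measure.

(** * Weak-star convergence and integrals of continuous functions *)

Lemma cvg_weak_starP (R : realType) (M : ptopologicalType) (T : Type)
    (F : set_system T) (u : T -> borel_probability M R)
    (nu : borel_probability M R) : Filter F ->
  ((u : T -> weak_star M R) @ F --> (nu : weak_star M R)) <->
  forall phi : continuousType M R,
    (\int[u t]_x phi x @[t --> F] --> \int[nu]_x phi x).
Proof.
move=> FF; split => [h phi|h].
  have /cvg_prod_topologyP/(_ phi) :
      (fun t => integrals (u t)) @ F --> integrals nu.
    by apply: cvg_comp h _; exact: (@initial_continuous _ _ (@integrals M R)).
  exact.
move=> U [_ [[W oW <-]] /= Wg /filterS]; apply.
have : (fun t => integrals (u t)) @ F --> integrals nu.
  by apply/cvg_prod_topologyP => phi; exact: h.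
by apply; exact: open_nbhs_nbhs.
Qed.

Lemma continuous_borel_measurable (R : realType) (M : ptopologicalType)
  (phi : M -> R) : continuous phi -> measurable_fun setT (phi : borel M -> R).
Proof.
move=> /continuousP cphi; apply: (measurability _ (RGenOInfty.measurableE R)).
move=> _ [_ [a ->] <-]; rewrite setTI; apply: sub_sigma_algebra.
exact/cphi/interval_open.
Qed.

Lemma continuous_compact_bounded (R : realType) (M : ptopologicalType)
  (phi : M -> R) : compact [set: M] -> continuous phi ->
  exists C, forall x, `|phi x| <= C.
Proof.
move=> cM cphi.
have [||c _ cP] := @compact_EVT_max _ R (fun x => `|phi x|) setT _ cM.
- by exists point.
- by apply: continuous_subspaceT => x; apply: cvg_norm; exact: cphi.
by exists `|phi c| => x; apply: cP; rewrite inE.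
Qed.

Lemma continuous_comp_integrable (R : realType) (M : ptopologicalType)
  (phi : M -> R) d (X : measurableType d) (P : probability X R)
  (T : X -> borel M) : compact [set: M] -> continuous phi ->
  measurable_fun setT T -> P.-integrable setT (EFin \o (phi \o T)).
Proof.
move=> cM cphi mT; apply: measurable_bounded_integrable => //.
- by rewrite (le_lt_trans (probability_le1 _ _)) ?ltry.
- exact: measurableT_comp (continuous_borel_measurable cphi) mT.
have [C CP] := continuous_compact_bounded cM cphi.
exists C; split; first exact: num_real.
by move=> r Cr x _; apply: le_trans (CP (T x)) _; exact: ltW.
Qed.

Lemma continuous_integrable (R : realType) (M : ptopologicalType)
  (phi : M -> R) (nu : borel_probability M R) :
  compact [set: M] -> continuous phi ->
  nu.-integrable setT (EFin \o (phi : borel M -> R)).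
Proof.
by move=> cM cphi; apply: (@continuous_comp_integrable _ _ _ _ _ nu id).
Qed.

Section step_functions.
Context d (X : measurableType d) (R : realType) (P : probability X R).

Lemma Rintegral_sum_indic (I : Type) (s : seq I) (c : I -> R) (A : I -> set X) :
  (forall i, measurable (A i)) ->
  P.-integrable setT (EFin \o (fun x => \sum_(i <- s) c i * \1_(A i) x)) /\
  \int[P]_x (\sum_(i <- s) c i * \1_(A i) x) = \sum_(i <- s) c i * fine (P (A i)).
Proof.
move=> mA; elim: s => [|i s [IH1 IH2]].
  rewrite big_nil (_ : (fun x => _) = cst 0); last first.
    by apply/funext => x; rewrite big_nil.
  split; last by rewrite Rintegral_cst// mul0r.
  exact: (finite_measure_integrable_cst P 0).
have ii : P.-integrable setT (EFin \o (fun x => c i * \1_(A i) x)).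
  rewrite (_ : _ \o _ = fun x => (c i)%:E * (\1_(A i) x)%:E)%E//.
  by apply: integrableZl => //; exact: integrable_indic.
rewrite big_cons.
have -> : (fun x => \sum_(j <- i :: s) c j * \1_(A j) x) =
   (fun x => c i * \1_(A i) x + \sum_(j <- s) c j * \1_(A j) x).
  by apply/funext => x; rewrite big_cons.
split; first exact: integrableD ii IH1.
rewrite RintegralD// IH2 RintegralZl//; last exact: integrable_indic.
by congr (_ * _ + _); rewrite /Rintegral integral_indic// setIT.
Qed.

Lemma Rintegral_finite_range (s : X -> seq bool) n (c : seq bool -> R) :
  (forall x, size (s x) = n) -> (forall w, measurable [set x | s x = w]) ->
  P.-integrable setT (EFin \o (c \o s)) /\
  \int[P]_x c (s x) =
    \sum_(w : n.-tuple bool) c w * fine (P [set x | s x = w]).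
Proof.
move=> ss ms.
have E : c \o s = fun x =>
    \sum_(w : n.-tuple bool) c w * \1_[set x | s x = w] x.
  apply/funext => x /=; have /eqP sx := ss x; rewrite (bigD1 (Tuple sx))//=.
  rewrite indicE mem_set// mulr1 big1 ?addr0// => w wx.
  rewrite indicE memNset ?mulr0//= => sxw; case/eqP: wx.
  exact: val_inj.
have [] := Rintegral_sum_indic (index_enum {: n.-tuple bool}) c
  (fun w => ms (val w)).
by rewrite -E; split.
Qed.

Lemma le_norm_Rintegral_subr (f g : X -> R) e :
  P.-integrable setT (EFin \o f) -> P.-integrable setT (EFin \o g) ->
  (forall x, `|f x - g x| <= e) -> `|\int[P]_x f x - \int[P]_x g x| <= e.
Proof.
move=> fi gi fg; rewrite -RintegralB//.
have fgi : P.-integrable setT (EFin \o (fun x => f x - g x)).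
  exact: (integrableB measurableT fi gi).
apply: (le_trans (le_normr_Rintegral _ fgi)) => //.
rewrite -[leRHS](_ : \int[P]_x (cst e x) = e); last first.
  rewrite Rintegral_cst// -[RHS]mulr1; congr (_ * _).
  by rewrite [X in fine X](@probability_setT _ _ _ P).
apply: le_Rintegral => //; last exact: finite_measure_integrable_cst.
exact: integrable_norm fgi.
Qed.

End step_functions.

(** * Integrals computed through codes, and sequential compactness *)

Lemma measurable_code (M : ptopologicalType) (B : nat -> set M) n w :
  (forall i, open (B i)) ->
  measurable ([set y | mkseq (code B y) n = w] : set (borel M)).
Proof.
move=> oB; elim: n w => [|n IH] w.
  have [->|w0] := eqVneq w [::].
    by rewrite [X in measurable X](_ : _ = setT)//; apply/seteqP; split.
  rewrite [X in measurable X](_ : _ = set0)//; apply/seteqP; split => // y /=.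
  by move=> w0'; rewrite -w0' in w0.
elim/last_ind: w => [|w b _].
  by rewrite [X in measurable X](_ : _ = set0)//; apply/seteqP; split.
rewrite [X in measurable X](_ : _ = [set y | mkseq (code B y) n = w] `&`
  (if b then B n else ~` B n)); last first.
  apply/seteqP; split => y /=; rewrite mkseqS.
    move=> /rcons_inj[-> <-]; split => //.
    by rewrite /code; case: asboolP.
  move=> [-> yb]; congr rcons; move: yb; rewrite /code.
  by case: b => yb; [apply/asboolP|apply/asboolPn].
apply: measurableI => //.
have mB : measurable (B n : set (borel M)) by apply: sub_sigma_algebra; exact: oB.
by case: b => //; exact: measurableC.
Qed.

Section coding_integral.
Variables (R : realType) (M : ptopologicalType) (B : nat -> set M).
Hypothesis cM : compact [set: M].
Hypothesis oB : forall i, open (B i).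
Hypothesis sepB : forall x y, x <> y -> exists2 i, B i x & ~ closure (B i) y.

(** By compactness, the decoded point lies in a closed set exactly when, for every [n], the cylinder
    of the first [n] digits meets that set. This is a countable condition on the digits. *)
Lemma measurable_decode d (X : measurableType d) (h : X -> nat -> bool)
    (T : X -> borel M) :
  (forall n w, measurable [set x | mkseq (h x) n = w]) ->
  (forall x n, cylinder B (mkseq (h x) n) (T x)) -> measurable_fun setT T.
Proof.
move=> mh hT; apply: (@measurability _ _ X (borel M) setT T (@open M)) => // _ [U oU <-].
rewrite setTI -[U]setCK -preimage_setC; apply: measurableC.
rewrite [X in measurable X](_ : _ = \bigcap_n \bigcup_(w in
    [set w | cylinder B w `&` ~` U !=set0]) [set x | mkseq (h x) n = w]).
  apply: bigcapT_measurable => n; rewrite bigcup_mkcond.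
  apply: countable_bigcupT_measurable => [|w]; first exact: countableP.
  by case: ifP => // _; exact: mh.
apply/seteqP; split => [x nUx n _|x xU].
  by exists (mkseq (h x) n) => //; exists (T x).
have [n|y nUy yh] := decode cM oB (h := h x) (open_closedC oU).
  by have [w [y wy] /= ->] := xU n I; exists y.
by rewrite /= (decode_uniq sepB (hT x) yh).
Qed.

(** The depth [n] and the values [c] depend only on [phi] and [e], so a single step function serves
    for all measures of a sequence and for their limit, even on different spaces. *)
Lemma approx_step_integral (phi : M -> R) (e : R) : continuous phi -> 0 < e ->
  exists n (c : seq bool -> R), forall d (X : measurableType d)
    (P : probability X R) (h : X -> nat -> bool) (T : X -> borel M),
  (forall n w, measurable [set x | mkseq (h x) n = w]) ->
  (forall x n, cylinder B (mkseq (h x) n) (T x)) ->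
  `|\int[P]_x phi (T x) -
    \sum_(w : n.-tuple bool) c w * fine (P [set x | mkseq (h x) n = w])| <= e.
Proof.
move=> cphi e0; have [n hn] := cylinder_oscillation cM oB sepB cphi e0.
have [c hc] : exists c : seq bool -> R, forall w y, size w = n ->
    cylinder B w y -> `|phi y - c w| <= e.
  have [c hc] : {c : seq bool -> R & forall w, size w = n ->
    forall y, cylinder B w y -> `|phi y - c w| <= e}.
    apply: (@choice _ _ (fun w r => size w = n ->
      forall y, cylinder B w y -> `|phi y - r| <= e)) => w.
    have [[y wy]|w0] := pselect (cylinder B w !=set0).
      by exists (phi y) => sw z wz; apply/ltW; exact: (hn w).
    by exists 0 => _ y wy; exfalso; apply: w0; exists y.
  by exists c => w y sw; exact: hc.
exists n, c => d X P h T mh hT.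
have mT := measurable_decode mh hT.
have [ic <-] := Rintegral_finite_range P c
  (fun x => size_mkseq (h x) n) (mh n).
apply: le_norm_Rintegral_subr => //.
- exact: continuous_comp_integrable.
- by move=> x; apply: hc (hT x n); rewrite size_mkseq.
Qed.

End coding_integral.

(* The limit measure is the image of Lebesgue measure under the map decoding
   binary expansions distributed as the limiting masses of the code words. *)
Lemma weak_star_sequentially_compact (R : realType) (M : ptopologicalType)
    (nu : nat -> borel_probability M R) :
  hausdorff_space M -> compact [set: M] -> @second_countable M ->
  exists2 k, increasing_seq k & exists lim : borel_probability M R,
    (fun i => nu (k i) : weak_star M R) @ \oo --> (lim : weak_star M R).
Proof.
move=> hM cM sM.
have [B oB sepB] := second_countable_separating hM cM sM.
pose E (w : seq bool) : set (borel M) := [set y | mkseq (code B y) (size w) = w].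
have mE w : measurable (E w) by exact: measurable_code.
have fE n w : nu n (E w) \is a fin_num by exact: fin_num_measure.
(* Words are numbered by [pickle]; a number that codes no word gets the dummy value 0. *)
pose u n i := if unpickle i is Some w then fine (nu n (E w)) else 0.
have u01 n i : 0 <= u n i <= 1.
  rewrite /u; case: unpickle => [w|]; last by rewrite lexx ler01.
  by rewrite fine_ge0//= -lee_fin fineK// probability_le1.
have [k ik [p' up']] := bounded_subsequence u01.
pose p (w : seq bool) := p' (pickle w).
have up w : fine (nu (k n) (E w)) @[n --> \oo] --> p w.
  by have := up' (pickle w); rewrite /u pickleK.
have p_ge0 w : 0 <= p w.
  apply: (cvgr_to_ge (up w)); by apply: nearW => n; exact: fine_ge0.
have p_nil : p [::] = 1.
  apply: (cvg_unique _ (up [::])) => //.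
  rewrite (_ : (fun n => _) = cst 1); first exact: cvg_cst.
  apply/funext => n; rewrite (_ : E [::] = setT).
    by rewrite [X in fine X](@probability_setT _ _ _ (nu (k n))).
  by apply/seteqP; split.
have p_rcons w : p w = p (rcons w false) + p (rcons w true).
  apply: (cvg_unique _ (up w)) => //.
  rewrite (_ : (fun n => _) = fun n => fine (nu (k n) (E (rcons w false))) +
      fine (nu (k n) (E (rcons w true)))); first exact: cvgD.
  apply/funext => n; rewrite -fineD// -measureU//.
    congr (fine (nu (k n) _)); apply/seteqP; rewrite /E !size_rcons.
    split => y /=; rewrite !mkseqS; last by case=> /rcons_inj[].
    by move=> ->; case: (code B y (size w)); [right|left].
  apply/seteqP; split => // y; rewrite /E /= !size_rcons !mkseqS.
  by move=> [/rcons_inj[_ ->] /rcons_inj[_]].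
have [P [h [mh Ph h_gt0]]] := tree_measure p_ge0 p_nil p_rcons.
(* A point with code word [w] lies in the cylinder of [w]; if that is empty, all the masses of [E w]
   vanish and so does their limit. *)
have cyl_gt0 w : 0 < p w -> cylinder B w !=set0.
  apply: contraPP => w0; apply/negP; rewrite -leNgt.
  apply: (cvgr_to_le (up w)); apply: nearW => n.
  rewrite (_ : E w = set0) ?measure0//; apply/seteqP; split => // y yw.
  apply: w0; exists y; rewrite -[w]yw; exact: cylinder_code.
have [T hT] : {T : measurableTypeR R -> borel M & forall t n,
    cylinder B (mkseq (h t) n) (T t)}.
  apply: (@choice _ _ (fun t y => forall n, cylinder B (mkseq (h t) n) y)) => t.
  have [n|y _ yh] := decode cM oB (h := h t) closedT; last by exists y.
  by rewrite setIT; exact/cyl_gt0.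
have mT : measurable_fun setT T := measurable_decode cM oB sepB mh hT.
pose T' : {mfun measurableTypeR R >-> borel M} :=
  HB.pack T (isMeasurableFun.Build _ _ _ _ _ mT).
exists k => //; exists (distribution P T' : borel_probability M R).
apply/cvg_weak_starP => phi; apply/cvgrPdist_lt => e e0.
have cphi : continuous phi by exact: cts_fun.
(* Three errors have to stay below [e] in total: one step approximation for each of the two
   measures, and the distance between the two step sums. *)
have e4 : 0 < e / 4 by rewrite divr_gt0.
have [n [c hc]] := approx_step_integral cM oB sepB cphi e4.
have -> : \int[distribution P T']_x phi x = \int[P]_t phi (T t).
  congr fine; rewrite integral_pushforward//.
  - by apply/measurable_EFinP; exact: continuous_borel_measurable.
  - exact: continuous_comp_integrable.
have hl := hc _ _ P h T mh hT.
(* On [M] itself the code of a point decodes to that point, hence the decoding map [id]. *)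
have hk i := hc _ _ (nu (k i)) (code B) id (fun n w => @measurable_code _ B n w oB)
   (@cylinder_code _ B).
have lim_step : (\sum_(w : n.-tuple bool) c w *
      fine (nu (k i) [set x | mkseq (code B x) n = w]) @[i --> \oo] -->
    \sum_(w : n.-tuple bool) c w * fine (P [set x | mkseq (h x) n = w])).
  apply: cvg_big => [|w _]; first exact: add_continuous.
  apply: cvgM; first exact: cvg_cst.
  have := Ph w; rewrite size_tuple => ->.
  by have := up w; rewrite /E size_tuple.
move/cvgrPdist_lt : lim_step => /(_ _ e4); apply: filterS => i hi.
move: hl (hk i) hi; rewrite /=.
set a := \int[P]_x _; set b := \int[nu _]_x _.
set a' := \sum_(_ | _) _; set b' := \sum_(_ | _) _.
rewrite !ler_norml !ltr_norml; lra.
Qed.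

(** * Subadditive potentials: a negative integral and a Birkhoff bound *)

Lemma limn_esup_le_near (R : realType) (u : (\bar R)^nat) (l : \bar R) :
  (\forall n \near \oo, (u n <= l)%E) -> (limn_esup u <= l)%E.
Proof.
move=> ul; apply: (le_trans _ (_ : ereal_sup [set u n | n in
    [set n | (u n <= l)%E]] <= l)%E).
  by apply: ereal_inf_lbound; exists [set n | (u n <= l)%E].
by apply: ge_ereal_sup => _ [n nl <-].
Qed.

(** If the integral were at most [C], the positive part [L'] of [L - C] would have integral 0, as
    [P] has mass 1, and would vanish almost everywhere. *)
Lemma lt_integral_ae d (X : measurableType d) (R : realType)
    (P : probability X R) (L : X -> \bar R) (C : R) :
  0 <= C -> measurable_fun setT L -> (forall x, 0 <= L x)%E ->
  (\forall x \ae P, C%:E < L x)%E -> (C%:E < \int[P]_x L x)%E.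
Proof.
move=> C0 mL L0 aL; rewrite ltNge; apply/negP => LC.
pose L' x := maxe (L x - C%:E)%E 0%E.
have mL' : measurable_fun setT L'.
  by apply: measurable_maxe => //; apply: emeasurable_funB.
have L'0 x : (0 <= L' x)%E by rewrite le_max lexx orbT.
have LE : (\int[P]_x L x = C%:E + \int[P]_x L' x)%E.
  transitivity (\int[P]_x (C%:E + L' x))%E.
    apply: ge0_ae_eq_integral => //.
    - by apply: emeasurable_funD.
    - by move=> x _; rewrite adde_ge0.
    apply: filterS aL => x CL _; rewrite /L' max_l ?sube_ge0 ?(ltW CL)//.
    by rewrite addeC subeK.
  rewrite ge0_integralD//.
  by rewrite integral_cst// [X in (_ * X)%E](@probability_setT _ _ _ P) mule1.
have iL' : (\int[P]_x `|L' x| = 0)%E.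
  under eq_integral do rewrite gee0_abs//.
  apply/eqP; rewrite eq_le integral_ge0 ?andbT//.
  by move: LC; rewrite LE -[leRHS]adde0 leeD2lE.
have := ae_eq_integral_abs P measurableT mL'.
move=> [/(_ iL') aL' _].
have P0 : (0 < P setT)%E by rewrite probability_setT.
have PF := ae_properfilter_algebraOfSetsType P0.
have : (\forall x \ae P, False).
  near=> x.
  have CL : (C%:E < L x)%E by near: x.
  have : L' x = 0%E by near: x; apply: filterS aL' => y; exact.
  rewrite /L' => /eqP; rewrite eq_le ge_max lexx andbT => /andP[+ _].
  by rewrite leeBlDr// add0e leNgt CL.
by move/filter_ex => -[].
Unshelve. all: by end_near. Qed.

Section subadditive.
Variables (R : realType) (M : ptopologicalType) (f : M -> M) (Phi : nat -> M -> R).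
Hypothesis cM : compact [set: M].
Hypothesis hPhi : subadditive_potential f Phi.

Lemma subadditive_bound : exists C, forall n x, Phi n.+1 x <= n.+1%:R * C.
Proof.
have [C CP] :=
  continuous_compact_bounded cM (subadditive_continuous hPhi (ltn0Sn 0)).
exists C; elim=> [|n IH] x; first by rewrite mul1r (le_trans (ler_norm _)).
apply: (le_trans (subadditive_le hPhi (n := 1) (m := n.+1) x _ _)) => //.
by rewrite -natr1 mulrDl mul1r addrC lerD// (le_trans (ler_norm _)).
Qed.

(* For [n = 0] the potential need not be measurable, but [0^-1 = 0]. *)
Lemma mean_growth_measurable n :
  measurable_fun setT (fun x : borel M => mean_growth Phi x n).
Proof.
apply/measurable_EFinP; case: n => [|n].
  rewrite (_ : (fun x => _) = cst 0); first exact: measurable_cst.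
  by apply/funext => x; rewrite invr0 mul0r.
apply: continuous_borel_measurable => x.
by apply: cvgM; [exact: cvg_cst|exact: (subadditive_continuous hPhi)].
Qed.

(* Fatou's lemma applied to [C - Phi n / n], which is nonnegative. *)
Lemma subadditive_integral_neg (mu : borel_probability M R) :
  {ae mu, forall x : M,
    cvgn (mean_growth Phi x) /\ (growth_rate Phi x < 0)%E} ->
  exists2 N, (0 < N)%N & \int[mu]_x Phi N x < 0.
Proof.
move=> hneg; apply: contrapT => hN.
have N0 N : (0 < N)%N -> 0 <= \int[mu]_x Phi N x.
  by move=> N_gt0; rewrite leNgt; apply/negP => ?; apply: hN; exists N.
have [C' C'P] := subadditive_bound.
(* Nonnegative, so that it also bounds the term of index 0, which is 0. *)
pose C := Num.max C' 0.
have C0 : 0 <= C by rewrite le_max lexx orbT.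
have uC n x : (mean_growth Phi x n <= C%:E)%E.
  rewrite lee_fin; case: n => [|n]; first by rewrite invr0 mul0r.
  rewrite ler_pdivrMl ?ltr0n// (le_trans (C'P _ _))// ler_wpM2l//.
  by rewrite le_max lexx.
pose F n (x : borel M) := (C%:E - mean_growth Phi x n)%E.
have mF n : measurable_fun setT (F n).
  by apply: emeasurable_funB => //; exact: mean_growth_measurable.
have F0 n x : (0 <= F n x)%E by rewrite /F sube_ge0.
have iF n : (\int[mu]_x F n x <= C%:E)%E.
  case: n => [|n].
    under eq_integral do rewrite /F /mean_growth invr0 mul0r sube0.
    by rewrite integral_cst// [X in (_ * X)%E](@probability_setT _ _ _ mu) mule1.
  have iPhi := continuous_integrable mu cM (subadditive_continuous hPhi (ltn0Sn n)).
  rewrite (_ : (fun x => F n.+1 x) =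
    EFin \o (fun x : borel M => C - n.+1%:R^-1 * Phi n.+1 x)); last first.
    by apply/funext => x; rewrite /F /mean_growth /= EFinB.
  have iP' : mu.-integrable setT (EFin \o fun x : borel M => n.+1%:R^-1 * Phi n.+1 x).
    rewrite (_ : _ \o _ = fun x : borel M => (n.+1%:R^-1)%:E * (Phi n.+1 x)%:E)%E//.
    exact: integrableZl.
  have iC := finite_measure_integrable_cst mu C measurableT.
  have iF := integrableB measurableT iC iP'.
  rewrite -(fineK (integrable_fin_num measurableT iF)) lee_fin.
  rewrite [leLHS](RintegralB measurableT iC iP').
  rewrite RintegralZl//.
  rewrite (Rintegral_cst _ measurableT).
  rewrite [X in _ * fine X](@probability_setT _ _ _ mu) mulr1.
  by rewrite gerBl mulr_ge0// N0.
pose L x := limn_einf (F ^~ x).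
have mL : measurable_fun setT L.
  rewrite (_ : L = fun x => - limn_esup (-%E \o F ^~ x))%E.
    apply: measurableT_comp => //; apply: measurable_fun_limn_esup.
    by move=> n; apply: measurableT_comp.
  by apply/funext => x; rewrite limn_esupN oppeK.
have L0 x : (0 <= L x)%E.
  rewrite oppe_ge0; apply: limn_esup_le_near; apply: nearW => n.
  by have := F0 n x; rewrite -oppe_le0.
(* The limit of [F] exceeds [C] strictly since the growth rate is negative, possibly [-oo]; Fatou
   with [iF] bounds the integral of [L] by [C], a contradiction. *)
have aL : (\forall x \ae mu, C%:E < L x)%E.
  apply: (@filterS _ _ (ae_filter_ringOfSetsType mu) _ _ _ hneg) => x [cx gx].
  have : F ^~ x @ \oo --> (C%:E - growth_rate Phi x)%E.
    apply: cvgeB; [|exact: cvg_cst|exact: cx].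
    by rewrite fin_num_adde_defr.
  rewrite /L => /cvg_limn_einf_sup[-> _].
  by rewrite lteDl// oppe_gt0.
have := lt_integral_ae C0 mL L0 aL.
rewrite ltNge => /negP; apply.
apply: (le_trans (fatou mu measurableT mF (fun n x _ => F0 n x))).
apply: (le_trans (limn_einf_sup _)).
by apply: limn_esup_le_near; apply: nearW => n; exact: iF.
Qed.

End subadditive.

(* Summing [Phi (n + N) <= Phi n + Phi N o f^n] over N consecutive shifts makes
   the left-hand side telescope. *)
Lemma subadditive_birkhoff_bound (R : realType) (M : ptopologicalType)
    (f : M -> M) (Phi : nat -> M -> R) (N : nat) (x : M) :
  compact [set: M] -> subadditive_potential f Phi -> (0 < N)%N ->
  exists K, forall n,
    N%:R * Phi (n.+1 + N)%N x <= \sum_(j < n.+1) Phi N (iter j f x) + K.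
Proof.
move=> cM hPhi N0.
have [C CP] : {C : nat -> R & forall j y, `|Phi j.+1 y| <= C j}.
  apply: (@choice _ _ (fun j c => forall y, `|Phi j.+1 y| <= c)) => j.
  by apply: continuous_compact_bounded cM _; exact: (subadditive_continuous hPhi).
(* A sliding window of [N] consecutive terms: moving it by one adds [Phi (n + N)] and drops
   [Phi n]. *)
pose A n := \sum_(i < N) Phi (n + i)%N x.
have A_S n : A n.+2 <= A n.+1 + Phi N (iter n.+1 f x).
  have -> : A n.+2 = A n.+1 + Phi (n.+1 + N)%N x - Phi n.+1 x.
    have := erefl (\sum_(i < N.+1) Phi (n.+1 + i)%N x).
    rewrite {1}big_ord_recr big_ord_recl /= addn0 => ->.
    rewrite addrAC subrr add0r.
    by apply: eq_bigr => i _; rewrite /= /bump addnS.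
  rewrite -addrA lerD2l lerBlDl.
  exact: subadditive_le.
(* The window starts at index 1 because [Phi 0] is unconstrained; subtracting [Phi N x] offsets the
   term [j = 0] of the Birkhoff sum. *)
have A_sum n : A n.+1 <=
    \sum_(j < n.+1) Phi N (iter j f x) + (A 1%N - Phi N x).
  elim: n => [|n IH]; first by rewrite big_ord1 addrC subrK.
  apply: (le_trans (A_S n)); rewrite big_ord_recr /= addrAC.
  by rewrite lerD2r.
(* Each of the [N] copies is split at a different index of the window; the remaining [Phi (N - i)]
   is bounded uniformly on [M]. *)
have PhiA n : N%:R * Phi (n.+1 + N)%N x <= A n.+1 + \sum_(j < N) C j.
  have -> : N%:R * Phi (n.+1 + N)%N x = \sum_(i < N) Phi (n.+1 + N)%N x.
    by rewrite sumr_const card_ord mulr_natl.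
  rewrite [X in _ <= _ + X](reindex_inj rev_ord_inj) -big_split /=.
  apply: ler_sum => i _; have iN := ltn_ord i.
  rewrite [X in Phi X x <= _](_ : _ = (n.+1 + i) + (N - i))%N; last first.
    by rewrite -addnA subnKC// ltnW.
  apply: (le_trans (subadditive_le hPhi x _ _)); rewrite ?subn_gt0//.
  rewrite lerD2l (le_trans (ler_norm _))//.
  by have := CP (N - i.+1)%N; rewrite -subSn// subSS; exact.
exists (A 1%N - Phi N x + \sum_(j < N) C j) => n.
by apply: (le_trans (PhiA n)); rewrite addrA lerD2r.
Qed.

(** * Averages along an orbit *)

Lemma Rintegral_empirical (R : realType) (M : ptopologicalType) (f : M -> M)
    (x : M) (n : nat) (phi : M -> R) : compact [set: M] -> continuous phi ->
  \int[empirical R f x n]_y phi y =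
    n.+1%:R^-1 * \sum_(j < n.+1) phi (iter j f x).
Proof.
move=> cM cphi; have [C CP] := continuous_compact_bounded cM cphi.
pose P : borel_probability M R := empirical R f x n.
have iphi : P.-integrable setT (EFin \o (phi : borel M -> R)).
  exact: continuous_integrable.
have iC := finite_measure_integrable_cst P C measurableT.
have PC : \int[P]_y (cst C y) = C.
  rewrite (Rintegral_cst _ measurableT).
  by rewrite [X in _ * fine X](@probability_setT _ _ _ P) mulr1.
have pC0 y : 0 <= phi y + C.
  by have := CP y; rewrite ler_norml => /andP[? _]; rewrite -lerBlDr sub0r.
(* Adding [C] makes the integrand nonnegative, as the rules for scaled measures and sums of measures
   require. *)
suff E : \int[P]_y (phi y + C) = n.+1%:R^-1 * \sum_(j < n.+1) phi (iter j f x) + C.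
  have := RintegralD measurableT iphi iC.
  by rewrite PC [LHS]E => /addIr.
have mphiC : measurable_fun setT (fun y : borel M => (phi y + C)%:E).
  apply/measurable_EFinP; apply: measurable_funD => //.
  exact: continuous_borel_measurable.
rewrite /Rintegral ge0_integral_mscale//; last by move=> y _; rewrite lee_fin.
rewrite ge0_integral_measure_sum//; last by move=> y _; rewrite lee_fin.
under eq_bigr do rewrite integral_dirac// diracT mul1e.
rewrite sumEFin -EFinM /= big_split/= mulrDr sumr_const card_ord -[C *+ _]mulr_natl.
by rewrite mulrA mulVf ?mul1r// pnatr_eq0.
Qed.

Lemma exists_increasing_seq (Q : nat -> Prop) :
  (forall m, exists2 n, (m <= n)%N & Q n) ->
  exists2 k, increasing_seq k & forall n, Q (k n).
Proof.
move=> hQ; have [g gP] : {g : nat -> nat & forall m, (m <= g m)%N /\ Q (g m)}.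
  apply: (@choice _ _ (fun m n => (m <= n)%N /\ Q n)) => m.
  by have [n ? ?] := hQ m; exists n.
exists (fun n => iter n (fun m => g m.+1) (g 0%N)).
  by apply/increasing_seqP => n; have [] := gP (iter n (fun m => g m.+1) (g 0%N)).+1.
by case=> [|n]; [have [] := gP 0%N|have [] := gP (iter n (fun m => g m.+1) (g 0%N)).+1].
Qed.

(** Otherwise the averages are at least [c'] along a subsequence; a weak-star limit extracted from
    it has integral at least [c'], hence above [c]. *)
Lemma empirical_limits_eventually (R : realType) (M : ptopologicalType)
    (f : M -> M) (x : M) (phi : M -> R) (c c' : R) :
  hausdorff_space M -> compact [set: M] -> @second_countable M ->
  continuous phi -> c < c' ->
  (forall nu, @empirical_limits R M f x nu -> \int[nu]_y phi y <= c) ->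
  \forall n \near \oo, \sum_(j < n.+1) phi (iter j f x) <= n.+1%:R * c'.
Proof.
move=> hM cM sM cphi cc' lim_c; apply: contrapT => not_near.
have [|k ik kP] := @exists_increasing_seq
  (fun n => n.+1%:R * c' <= \sum_(j < n.+1) phi (iter j f x)) _.
  move=> m; apply: contrapT => hm; apply: not_near; exists m => // n /= mn.
  by rewrite leNgt; apply/negP => /ltW h; apply: hm; exists n.
have [k' ik' [nu nuP]] := weak_star_sequentially_compact
  (fun i => empirical R f x (k i) : borel_probability M R) hM cM sM.
have /lim_c : empirical_limits f x nu.
  exists (k \o k') => // m n /=.
  by rewrite ik; exact: ik'.
apply/negP; rewrite -ltNge; apply: (lt_le_trans cc').
pose phi' : continuousType M R := HB.pack phi (isContinuous.Build _ _ phi cphi).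
move/cvg_weak_starP : nuP => /(_ phi') /cvgr_to_ge; apply; apply: nearW => i.
by rewrite Rintegral_empirical// ler_pdivlMl.
Qed.

Theorem theorem2p9 (R : realType) (d : nat) (M : ptopologicalType)
    (hM : is_manifold R d M) (cM : compact [set: M])
    (dist : borel_probability M R -> borel_probability M R -> R)
    (hdist : weak_star_metric dist)
    (f : M -> M) (cf : continuous f)
    (mu : borel_probability M R) (hmu : invariant_measure f mu)
    (Phi : nat -> M -> R) (hPhi : subadditive_potential f Phi)
    (hneg : {ae mu, forall x : M,
       cvgn (mean_growth Phi x) /\ (growth_rate Phi x < 0)%E}) :
  exists2 e : R, 0 < e &
    forall x : M, strong_basin dist f mu e x ->
      (largest_growth_rate Phi x < 0)%E.
Proof.
have hausM := manifold_hausdorff hM; have sM := manifold_second_countable hM.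
have [N N0 intN] := subadditive_integral_neg cM hPhi hneg.
have cN := subadditive_continuous hPhi N0.
(* Half of a negative integral is strictly larger than it, so [mu] lies in the open set where the
   integral of [Phi N] is below [c]. *)
set c := (\int[mu]_x Phi N x) / 2.
have c0 : c < 0 by rewrite /c; lra.
have nS : nbhs (mu : weak_star M R)
    [set nu : weak_star M R | \int[(nu : borel_probability M R)]_x Phi N x < c].
  pose phi : continuousType M R := HB.pack (Phi N) (isContinuous.Build _ _ (Phi N) cN).
  have [h _] := @cvg_weak_starP R M _ (nbhs (mu : weak_star M R)) id mu _.
  have /cvgr_lt := h cvg_id phi.
  by apply; rewrite /c /=; lra.
move: nS; rewrite (wsm_nbhs hdist) => -[e e0 eS]; exists e => // x xe.
have cc2 : c < c / 2 by lra.
have := empirical_limits_eventually hausM cM sM cN cc2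
  (fun nu xnu => ltW (eS nu (xe nu xnu))).
have [K KP] := subadditive_birkhoff_bound x cM hPhi N0.
move=> [n0 _ n0P].
have NR : 0 < N%:R :> R by rewrite ltr0n.
(* The orbit averages of [Phi N] are eventually at most [c / 2], which suggests the rate
   [c / (2 * N)]; half of it is given up to absorb [K] and the shift by [N]. *)
pose l := c / (4 * N%:R).
have l0 : l < 0 by rewrite /l pmulr_llt0// invr_gt0 mulr_gt0.
apply: (@le_lt_trans _ _ l%:E); last by rewrite lte_fin.
apply: limn_esup_le_near; near=> m.
(* The second bound on [m] is [K - N * (c / 2) <= - m * (c / 4)] solved for [m]. *)
have [mN0 mK] : (n0 + N < m)%N /\ (K - N%:R * (c / 2)) * 4 / - c <= m%:R.
  by split; near: m; [exact: nbhs_infty_gt|exact: nbhs_infty_ger].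
have mR : 0 < m%:R :> R by rewrite ltr0n (leq_trans _ mN0).
rewrite /mean_growth lee_fin ler_pdivrMl// /l mulrA ler_pdivlMr ?mulr_gt0//.
move: mK; rewrite ler_pdivrMr ?oppr_gt0// => mK.
have mE : m = ((m - N.+1).+1 + N)%N.
  by rewrite addSnnS subnK// (leq_trans _ mN0)// ltnS leq_addl.
have := KP (m - N.+1)%N; rewrite -mE => KPm.
have := n0P (m - N.+1)%N; rewrite /= leq_subRL; last first.
  by rewrite (leq_trans _ mN0)// ltnS leq_addl.
rewrite addSn addnC => /(_ mN0) hm.
have mNR : (m - N.+1).+1%:R = m%:R - N%:R :> R by rewrite [in RHS]mE natrD addrK.
move: hm; rewrite mNR => hm; nra.
Unshelve. all: by end_near. Qed.
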